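(* Let $V$ be the set of integer points $(x,y,z)\in\mathbb{Z}^3$ such that none of $x+y,\ x-y,\ y+z,\ y-z,\ z+x,\ z-x$ is congruent to $0 \pmod 4$, and let $G$ be the graph (the sodalite network) with vertex set $V$ in which two vertices are adjacent exactly when their Euclidean distance is $\sqrt{2}$. Let $O=(0,1,2)$ and, for $P\in V$, let $\operatorname{dis}(P)$ denote the graph distance in $G$ from $O$ to $P$. Define $h:V\to\mathbb{R}$ as follows. For $P=(x,y,z)\in V$ let $x'\ge y'\ge z'\ge 0$ be the absolute values $|x|,|y|,|z|$ sorted in decreasing order, and put $$h'(P)=x'+\tfrac{y'}{2}-\tfrac{s}{2},\qquad s=a(y' \bmod 4)\cdot b(x' \bmod 4),$$ where $(a(0),a(1),a(2),a(3))=(0,1,0,-1)$ and $(b(0),b(1),b(2),b(3))=(1,0,-1,0)$. Then $h(P)=h'(P)+c(P)$, where, writing $\operatorname{sig}$ for the sign function, $c(P)=0$ if $|x|\ge|y|\ge|z|$; $c(P)=-\operatorname{sig}(z)$ if $|x|\ge|z|\ge|y|$; $c(P)=-\operatorname{sig}(y)$ if $|y|\ge|x|\ge|z|$; $c(P)=0$ if $|y|\ge|z|\ge|x|$ and $yz\le 0$; $c(P)=-2\operatorname{sig}(z)$ if $|y|\ge|z|\ge|x|$ and $yz\ge 0$; $c(P)=-2\operatorname{sig}(z)$ if $|z|\ge|x|\ge|y|$; $c(P)=-\operatorname{sig}(z)$ if $|z|\ge|y|\ge|x|$ and $yz\le 0$; $c(P)=-3\operatorname{sig}(y)$ if $|z|\ge|y|\ge|x|$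 and $yz\ge 0$. Then $\operatorname{dis}(P)=h(P)$ for every $P\in V$.
   Context: $G$ is the edge-skeleton of the uniform tiling of Euclidean 3-space by truncated octahedra, scaled by a factor 4 so that vertices have integer coordinates; each vertex has exactly four neighbours (e.g. the neighbours of $(0,1,2)$ are $(0,2,1),(0,2,3),(1,0,2),(-1,0,2)$). For vertices in $V$ the absolute values $|x|,|y|,|z|$ are pairwise distinct, so exactly one case of the definition of $c(P)$ applies and the relevant signs are of nonzero coordinates. *)

(* Defs.v *)
From Stdlib Require Import ZArith Reals Bool.
Open Scope Z_scope.

Definition point := (Z * Z * Z)%type.

Definition inV (P : point) : Prop :=
  let '(x, y, z) := P in
  (x + y) mod 4 <> 0 /\ (x - y) mod 4 <> 0 /\ (y + z) mod 4 <> 0 /\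
  (y - z) mod 4 <> 0 /\ (z + x) mod 4 <> 0 /\ (z - x) mod 4 <> 0.

Definition adj (P Q : point) : Prop :=
  let '(x1, y1, z1) := P in
  let '(x2, y2, z2) := Q in
  (x1 - x2) * (x1 - x2) + (y1 - y2) * (y1 - y2) + (z1 - z2) * (z1 - z2) = 2.

Inductive walk : nat -> point -> point -> Prop :=
  | walk0 : forall P, inV P -> walk 0 P P
  | walkS : forall n P Q R, walk n P Q -> adj Q R -> inV R -> walk (S n) P R.

Definition O_pt : point := (0, 1, 2).

Definition graph_dist (P Q : point) (n : nat) : Prop :=
  walk n P Q /\ forall m, walk m P Q -> (n <= m)%nat.

Definition a_fun (r : Z) : Z :=
  match r with 0 => 0 | 1 => 1 | 2 => 0 | 3 => -1 | _ => 0 end.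
Definition b_fun (r : Z) : Z :=
  match r with 0 => 1 | 1 => 0 | 2 => -1 | 3 => 0 | _ => 0 end.

Definition xs (P : point) : Z :=
  let '(x, y, z) := P in Z.max (Z.abs x) (Z.max (Z.abs y) (Z.abs z)).
Definition zs (P : point) : Z :=
  let '(x, y, z) := P in Z.min (Z.abs x) (Z.min (Z.abs y) (Z.abs z)).
Definition ys (P : point) : Z :=
  let '(x, y, z) := P in Z.abs x + Z.abs y + Z.abs z - xs P - zs P.

Definition s_val (P : point) : Z :=
  a_fun (ys P mod 4) * b_fun (xs P mod 4).

Definition h' (P : point) : R :=
  (IZR (xs P) + IZR (ys P) / 2 - IZR (s_val P) / 2)%R.

Definition c_val (P : point) : Z :=
  let '(x, y, z) := P in
  let ax := Z.abs x in let ay := Z.abs y in let az := Z.abs z in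
  if (ay <=? ax) && (az <=? ay) then 0
  else if (ay <=? az) && (az <=? ax) then - Z.sgn z
  else if (ax <=? ay) && (az <=? ax) then - Z.sgn y
  else if (az <=? ay) && (ax <=? az) && (y * z <=? 0) then 0
  else if (az <=? ay) && (ax <=? az) && (0 <=? y * z) then -2 * Z.sgn z
  else if (ax <=? az) && (ay <=? ax) then -2 * Z.sgn z
  else if (ay <=? az) && (ax <=? ay) && (y * z <=? 0) then - Z.sgn z
  else if (ay <=? az) && (ax <=? ay) && (0 <=? y * z) then -3 * Z.sgn y
  else 0.

Definition h (P : point) : R := (h' P + IZR (c_val P))%R.

(* Main.v *)
(** Twice the candidate, [h2 = 2h], is an integer.  The theorem follows from two
    local facts: [h2] grows by at most 2 along an edge, and every vertex other
    than [O] has a neighbour at which [h2] is smaller by 2.  Both facts are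
    periodic.  If the sorted absolute values of the coordinates of [P] have a gap
    of at least 7 (counting 0 as a value), moving the coordinates above
    the gap by 4 towards the origin does not change the parity class, the order or
    the signs of the coordinates of [P] and its neighbours, so it changes [h2] by
    the same constant at all of them.  Hence it suffices to check the vertices
    without such a gap, and there are finitely many. *)

Require Import Defs.
From Stdlib Require Import ZArith Reals Bool List Lia Lra.
Import ListNotations.

(** * The doubled candidate *)

Definition h2 (P : point) : Z := 2 * xs P + ys P - s_val P + 2 * c_val P.

Lemma h2_double (P : point) : IZR (h2 P) = (2 * h P)%R.
Proof.
  unfold h, h', h2.
  rewrite !plus_IZR, minus_IZR, plus_IZR, !mult_IZR; lra.
Qed.

(** Makes descent along [h2] well-founded before it is known to be nonnegative: [s_val] contributes
    at least -1 and [2 * c_val] at least -6. *)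
Lemma h2_lower (P : point) : -7 <= h2 P.
Proof.
  assert (Ha : forall r, -1 <= a_fun r <= 1)
    by (intros [|[[|[]|]|[[]|[]|]|]|]; simpl; lia).
  assert (Hb : forall r, -1 <= b_fun r <= 1)
    by (intros [|[[|[]|]|[[]|[]|]|]|]; simpl; lia).
  assert (Hs : s_val P <= 1)
    by (unfold s_val; specialize (Ha (ys P mod 4));
        assert (E : a_fun (ys P mod 4) = -1 \/ a_fun (ys P mod 4) = 0 \/
          a_fun (ys P mod 4) = 1) by lia;
        specialize (Hb (xs P mod 4)); destruct E as [-> | [-> | ->]]; lia).
  assert (Hxy : 0 <= 2 * xs P + ys P)
    by (destruct P as [[x y] z]; unfold ys, xs, zs; lia).
  assert (Hc : -3 <= c_val P).
  { destruct P as [[x y] z]; unfold c_val; cbv zeta.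
    repeat match goal with |- context [if ?b then _ else _] => destruct b end;
      lia. }
  unfold h2; lia.
Qed.

(** * Translations by multiples of 4 as graph symmetries *)

Definition sub4 (P u : point) : point :=
  let '(x, y, z) := P in let '(a, b, c) := u in
  (x - 4 * a, y - 4 * b, z - 4 * c).

Lemma mod_sub4 (a b : Z) : (a - 4 * b) mod 4 = a mod 4.
Proof. rewrite <- (Z_mod_plus_full a (- b) 4); f_equal; ring. Qed.

Lemma inV_sub4 (P u : point) : inV (sub4 P u) <-> inV P.
Proof.
  destruct P as [[x y] z], u as [[a b] c]; unfold inV, sub4.
  replace (x - 4 * a + (y - 4 * b)) with (x + y - 4 * (a + b)) by ring.
  replace (x - 4 * a - (y - 4 * b)) with (x - y - 4 * (a - b)) by ring.
  replace (y - 4 * b + (z - 4 * c)) with (y + z - 4 * (b + c)) by ring.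
  replace (y - 4 * b - (z - 4 * c)) with (y - z - 4 * (b - c)) by ring.
  replace (z - 4 * c + (x - 4 * a)) with (z + x - 4 * (c + a)) by ring.
  replace (z - 4 * c - (x - 4 * a)) with (z - x - 4 * (c - a)) by ring.
  rewrite !mod_sub4; tauto.
Qed.

Lemma adj_sub4 (P Q u : point) : adj (sub4 P u) (sub4 Q u) <-> adj P Q.
Proof.
  destruct P as [[x y] z], Q as [[x' y'] z'], u as [[a b] c]; unfold adj, sub4.
  replace (x - 4 * a - (x' - 4 * a)) with (x - x') by ring.
  replace (y - 4 * b - (y' - 4 * b)) with (y - y') by ring.
  replace (z - 4 * c - (z' - 4 * c)) with (z - z') by ring.
  tauto.
Qed.

Lemma sub4_surj (Q u : point) : exists P, sub4 P u = Q.
Proof.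
  destruct Q as [[x y] z], u as [[a b] c].
  exists (x + 4 * a, y + 4 * b, z + 4 * c); simpl; repeat f_equal; ring.
Qed.

(** [u] is the sign of [v] if [v] lies beyond the gap [(t, t + g)] in absolute
    value, and [0] if [v] lies before it.  A gap of 7 at [P] leaves a gap of 5 at
    its neighbours, hence a strict order after the shift by 4; it also ensures
    that [P] is not shifted to [O]. *)
Definition beyond (g t u v : Z) : Prop :=
  u = 0 /\ Z.abs v <= t \/ u = 1 /\ t + g <= v \/ u = -1 /\ v <= - (t + g).

Definition beyond3 (g t : Z) (u P : point) : Prop :=
  let '(a, b, c) := u in let '(x, y, z) := P in
  beyond g t a x /\ beyond g t b y /\ beyond g t c z.

Lemma beyond_close (t u v v' : Z) : 0 <= t ->
  beyond 7 t u v -> -1 <= v' - v <= 1 -> beyond 5 (t + 1) u v'.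
Proof. unfold beyond; lia. Qed.

Lemma beyond_small (t u v : Z) : 0 <= t ->
  beyond 7 t u v -> -2 <= v - 4 * u <= 2 -> u = 0.
Proof. unfold beyond; lia. Qed.

(** * Effect on [h2] of a shift across a gap *)

Section Shift.

Variable t : Z.
Hypothesis t_pos : 0 < t.

Lemma abs_shift (u v : Z) :
  beyond 5 t u v -> Z.abs (v - 4 * u) = Z.abs v - 4 * Z.abs u.
Proof. unfold beyond; lia. Qed.

Lemma beyond_abs (u v : Z) : beyond 5 t u v ->
  Z.abs u = 0 /\ 0 <= Z.abs v <= t \/ Z.abs u = 1 /\ t + 5 <= Z.abs v.
Proof. unfold beyond; lia. Qed.

Lemma sgn_shift (u v : Z) : beyond 5 t u v -> Z.sgn (v - 4 * u) = Z.sgn v.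
Proof. unfold beyond; lia. Qed.

Lemma leb_shift (u v u' v' : Z) : beyond 5 t u v -> beyond 5 t u' v' ->
  (Z.abs (v - 4 * u) <=? Z.abs (v' - 4 * u')) = (Z.abs v <=? Z.abs v').
Proof. unfold beyond; lia. Qed.

(** The sign of a product depends only on the signs of its factors, which the shift preserves. *)
Lemma mul_leb0_shift (u v u' v' : Z) : beyond 5 t u v -> beyond 5 t u' v' ->
  ((v - 4 * u) * (v' - 4 * u') <=? 0) = (v * v' <=? 0).
Proof.
  intros H H'; apply sgn_shift in H, H'.
  apply eq_true_iff_eq; rewrite !Z.leb_le.
  now rewrite <- Z.sgn_nonpos, <- (Z.sgn_nonpos (v * v')), !Z.sgn_mul, H, H'.
Qed.

Lemma mul_geb0_shift (u v u' v' : Z) : beyond 5 t u v -> beyond 5 t u' v' ->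
  (0 <=? (v - 4 * u) * (v' - 4 * u')) = (0 <=? v * v').
Proof.
  intros H H'; apply sgn_shift in H, H'.
  apply eq_true_iff_eq; rewrite !Z.leb_le.
  now rewrite <- Z.sgn_nonneg, <- (Z.sgn_nonneg (v * v')), !Z.sgn_mul, H, H'.
Qed.

Lemma c_val_shift (u P : point) : beyond3 5 t u P -> c_val (sub4 P u) = c_val P.
Proof.
  destruct P as [[x y] z], u as [[a b] c]; intros (Hx & Hy & Hz).
  unfold c_val, sub4.
  rewrite !leb_shift, mul_leb0_shift, mul_geb0_shift, !sgn_shift by assumption.
  reflexivity.
Qed.

(** The absolute values of [u] are 0 before the gap and 1 beyond it, so one permutation sorts both
    [u] and [P], and the subtraction may be done after sorting. *)
Lemma xs_shift (u P : point) : beyond3 5 t u P -> xs (sub4 P u) = xs P - 4 * xs u.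
Proof.
  destruct P as [[x y] z], u as [[a b] c]; intros (Hx & Hy & Hz).
  unfold xs, sub4; rewrite !abs_shift by assumption.
  apply beyond_abs in Hx, Hy, Hz.
  destruct Hx as [[-> Hx] | [-> Hx]], Hy as [[-> Hy] | [-> Hy]],
    Hz as [[-> Hz] | [-> Hz]];
    revert Hx Hy Hz; generalize (Z.abs x) (Z.abs y) (Z.abs z); clear -t_pos; lia.
Qed.

Lemma ys_shift (u P : point) : beyond3 5 t u P -> ys (sub4 P u) = ys P - 4 * ys u.
Proof.
  destruct P as [[x y] z], u as [[a b] c]; intros (Hx & Hy & Hz).
  unfold ys, xs, zs, sub4; rewrite !abs_shift by assumption.
  apply beyond_abs in Hx, Hy, Hz.
  destruct Hx as [[-> Hx] | [-> Hx]], Hy as [[-> Hy] | [-> Hy]],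
    Hz as [[-> Hz] | [-> Hz]];
    revert Hx Hy Hz; generalize (Z.abs x) (Z.abs y) (Z.abs z); clear -t_pos; lia.
Qed.

(** Sorted values move by multiples of 4, so [s_val] is unchanged; [c_val] sees only order and
    signs. Only the linear part [2 * xs + ys] moves. *)
Lemma h2_shift (u P : point) :
  beyond3 5 t u P -> h2 (sub4 P u) = h2 P - (8 * xs u + 4 * ys u).
Proof.
  intros H; unfold h2, s_val.
  rewrite xs_shift, ys_shift, c_val_shift, !mod_sub4 by assumption; ring.
Qed.

End Shift.

(** * The two local facts and their transport along shifts *)

Definition good (P : point) : Prop :=
  (forall Q, adj P Q -> inV Q -> h2 Q <= h2 P + 2) /\
  (P = O_pt \/ exists Q, adj P Q /\ inV Q /\ h2 Q = h2 P - 2).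

(** The minimal vectors of the face-centred cubic lattice; from a given vertex only four of them
    lead to vertices. *)
Definition steps : list point :=
  [(0, 1, 1); (0, 1, -1); (0, -1, 1); (0, -1, -1);
   (1, 0, 1); (1, 0, -1); (-1, 0, 1); (-1, 0, -1);
   (1, 1, 0); (1, -1, 0); (-1, 1, 0); (-1, -1, 0)].

Definition add (P d : point) : point :=
  let '(x, y, z) := P in let '(a, b, c) := d in (x + a, y + b, z + c).

Lemma adj_close (P Q : point) : adj P Q ->
  let '(x, y, z) := P in let '(x', y', z') := Q in
  -1 <= x' - x <= 1 /\ -1 <= y' - y <= 1 /\ -1 <= z' - z <= 1.
Proof.
  assert (Hsq : forall a b, (a - b) * (a - b) <= 2 -> -1 <= b - a <= 1)
    by (intros; nia).
  destruct P as [[x y] z], Q as [[x' y'] z']; unfold adj; intros H.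
  pose proof (Z.square_nonneg (x - x')).
  pose proof (Z.square_nonneg (y - y')).
  pose proof (Z.square_nonneg (z - z')).
  repeat split; apply Hsq; lia.
Qed.

Lemma adj_add (P d : point) : In d steps -> adj P (add P d).
Proof.
  destruct P as [[x y] z]; simpl; intros H.
  repeat (destruct H as [<- | H]; [simpl; ring |]); contradiction.
Qed.

Lemma adj_steps (P Q : point) : adj P Q -> exists d, In d steps /\ Q = add P d.
Proof.
  intros H; pose proof (adj_close _ _ H) as Hc.
  destruct P as [[x y] z], Q as [[x' y'] z']; simpl in H.
  exists (x' - x, y' - y, z' - z); split; [| simpl; repeat f_equal; ring].
  destruct Hc as (Hx & Hy & Hz).
  assert (Ex : x' - x = -1 \/ x' - x = 0 \/ x' - x = 1) by lia.
  assert (Ey : y' - y = -1 \/ y' - y = 0 \/ y' - y = 1) by lia.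
  assert (Ez : z' - z = -1 \/ z' - z = 0 \/ z' - z = 1) by lia.
  (* In this form [H] becomes a closed equation in each of the 27 cases, false unless the squared
     length is 2. *)
  replace (x - x') with (- (x' - x)) in H by ring.
  replace (y - y') with (- (y' - y)) in H by ring.
  replace (z - z') with (- (z' - z)) in H by ring.
  revert H.
  destruct Ex as [-> | [-> | ->]], Ey as [-> | [-> | ->]], Ez as [-> | [-> | ->]];
    intros H; try discriminate H; simpl; auto 15.
Qed.

Lemma good_shift (t : Z) (u P : point) : 0 <= t -> u <> (0, 0, 0) ->
  beyond3 7 t u P -> good (sub4 P u) -> good P.
Proof.
  intros Ht Hu HP [Hlip Hdesc].
  assert (h2P : h2 (sub4 P u) = h2 P - (8 * xs u + 4 * ys u)).
  (* The threshold [t + 1] serves [P] and its neighbours alike, and is positive even when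
     [t = 0]. *)
  { apply (h2_shift (t + 1)); [lia |].
    destruct P as [[x y] z], u as [[a b] c]; destruct HP as (Hx & Hy & Hz).
    repeat split; eapply beyond_close; eauto; lia. }
  assert (h2Q : forall Q, adj P Q ->
    h2 (sub4 Q u) = h2 Q - (8 * xs u + 4 * ys u)).
  { intros Q HQ; apply (h2_shift (t + 1)); [lia |].
    apply adj_close in HQ.
    destruct P as [[x y] z], Q as [[x' y'] z'], u as [[a b] c].
    destruct HP as (Hx & Hy & Hz), HQ as (Ex & Ey & Ez).
    repeat split; eapply beyond_close; eauto. }
  split.
  - intros Q HQ VQ.
    rewrite <- (adj_sub4 P Q u) in HQ; rewrite <- (inV_sub4 Q u) in VQ.
    specialize (Hlip _ HQ VQ).
    rewrite adj_sub4 in HQ; rewrite h2P, (h2Q _ HQ) in Hlip; lia.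
  - destruct Hdesc as [E | (Q' & HQ & VQ & E)].
    (* A shifted coordinate keeps absolute value at least [t + 7 - 4 >= 3], while those of [O_pt]
       are at most 2. *)
    + exfalso; destruct P as [[x y] z], u as [[a b] c]; destruct HP as (Hx & Hy & Hz).
      apply pair_equal_spec in E as [[E1 E2]%pair_equal_spec E3].
      apply Hu; repeat f_equal; eapply beyond_small; eauto; lia.
    + destruct (sub4_surj Q' u) as [Q <-].
      rewrite adj_sub4 in HQ; rewrite inV_sub4 in VQ.
      right; exists Q; repeat split; trivial.
      rewrite h2P, (h2Q _ HQ) in E; lia.
Qed.

(** * The finite check *)

Definition inVb (P : point) : bool :=
  let '(x, y, z) := P in
  negb ((x + y) mod 4 =? 0) && negb ((x - y) mod 4 =? 0) &&
  negb ((y + z) mod 4 =? 0) && negb ((y - z) mod 4 =? 0) &&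
  negb ((z + x) mod 4 =? 0) && negb ((z - x) mod 4 =? 0).

Lemma inVbP (P : point) : inVb P = true <-> inV P.
Proof.
  destruct P as [[x y] z]; unfold inVb, inV.
  rewrite !andb_true_iff, !negb_true_iff, !Z.eqb_neq; tauto.
Qed.

Definition is_O (P : point) : bool :=
  let '(x, y, z) := P in (x =? 0) && (y =? 1) && (z =? 2).

Definition goodb (P : point) : bool :=
  let v := h2 P in
  let nb := filter inVb (map (add P) steps) in
  forallb (fun Q => h2 Q <=? v + 2) nb &&
  (is_O P || existsb (fun Q => h2 Q =? v - 2) nb).

Lemma goodb_good (P : point) : goodb P = true -> good P.
Proof.
  unfold goodb; rewrite andb_true_iff, orb_true_iff, forallb_forall, existsb_exists.
  intros [Hlip Hdesc]; split.
  - intros Q HQ VQ; destruct (adj_steps _ _ HQ) as (d & Hd & ->).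
    apply Z.leb_le, Hlip, filter_In; split; [now apply in_map | now apply inVbP].
  - destruct Hdesc as [E | (Q & HQ & E)].
    + left; destruct P as [[x y] z]; unfold is_O, O_pt in *.
      rewrite !andb_true_iff, !Z.eqb_eq in E.
      now destruct E as [[-> ->] ->].
    + right; exists Q.
      apply filter_In in HQ as [HQ VQ]; apply in_map_iff in HQ as (d & <- & Hd).
      repeat split; [now apply adj_add | now apply inVbP | now apply Z.eqb_eq].
Qed.

Definition range18 : list Z := map (fun n => Z.of_nat n - 18) (seq 0 37).

Lemma in_range18 (x : Z) : Z.abs x <= 18 -> In x range18.
Proof.
  intros H; apply in_map_iff; exists (Z.to_nat (x + 18)); rewrite in_seq; lia.
Qed.

(** Three successive gaps of at most 6, starting from 0, bound the sorted absolute values by 6, 12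
    and 18; the last bound fixes the cube to enumerate. *)
Definition core_ok (P : point) : bool :=
  if inVb P && ((ys P <=? 12) && (zs P <=? 6)) then goodb P else true.

Lemma core_ok_range : forallb (fun x => forallb (fun y => forallb (fun z =>
  core_ok (x, y, z)) range18) range18) range18 = true.
Proof. vm_cast_no_check (eq_refl true). Qed.

Lemma good_core (P : point) :
  xs P <= 18 -> ys P <= 12 -> zs P <= 6 -> inV P -> good P.
Proof.
  intros HX HY HZ HV; apply goodb_good.
  assert (H : core_ok P = true).
  { destruct P as [[x y] z]; unfold xs in HX.
    pose proof core_ok_range as H.
    rewrite forallb_forall in H; specialize (H x ltac:(apply in_range18; lia)).
    rewrite forallb_forall in H; specialize (H y ltac:(apply in_range18; lia)).
    rewrite forallb_forall in H; exact (H z ltac:(apply in_range18; lia)). }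
  apply inVbP in HV; apply Z.leb_le in HY, HZ.
  unfold core_ok in H; now rewrite HV, HY, HZ in H.
Qed.

(** * Reduction of every vertex to the finite core *)

Definition sgn_above (t v : Z) : Z := if Z.abs v <=? t then 0 else Z.sgn v.

Lemma gap_or_core (P : point) :
  (xs P <= 18 /\ ys P <= 12 /\ zs P <= 6) \/
  exists t u, 0 <= t /\ u <> (0, 0, 0) /\ beyond3 7 t u P.
Proof.
  assert (Hgap : forall t, 0 <= t < xs P ->
    (forall v, (let '(x, y, z) := P in v = x \/ v = y \/ v = z) ->
       Z.abs v <= t \/ t + 7 <= Z.abs v) ->
    exists t u, 0 <= t /\ u <> (0, 0, 0) /\ beyond3 7 t u P).
  { intros t [Ht HX] H; exists t; destruct P as [[x y] z].
    exists (sgn_above t x, sgn_above t y, sgn_above t z).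
    assert (Hb : forall v, v = x \/ v = y \/ v = z -> beyond 7 t (sgn_above t v) v)
      by (intros v Hv; specialize (H v Hv); unfold beyond, sgn_above;
          destruct (Z.leb_spec (Z.abs v) t); lia).
    split; [assumption | split; [| simpl; auto 7]].
    (* The witness is nonzero because [t < xs P]: some coordinate exceeds [t] in absolute value. *)
    assert (H0 : forall v, sgn_above t v = 0 -> Z.abs v <= t)
      by (intros v; unfold sgn_above; destruct (Z.leb_spec (Z.abs v) t); lia).
    intros E; apply pair_equal_spec in E as [[E1 E2]%pair_equal_spec E3].
    apply H0 in E1, E2, E3; unfold xs in HX; lia. }
  destruct (Z_le_gt_dec 7 (zs P)) as [Hz | Hz].
  { right; apply (Hgap 0); destruct P as [[x y] z]; unfold ys, xs, zs in *; lia. }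
  destruct (Z_le_gt_dec (zs P + 7) (ys P)) as [Hy | Hy].
  { right; apply (Hgap (zs P)); destruct P as [[x y] z]; unfold ys, xs, zs in *; lia. }
  destruct (Z_le_gt_dec (ys P + 7) (xs P)) as [Hx | Hx].
  { right; apply (Hgap (ys P)); destruct P as [[x y] z]; unfold ys, xs, zs in *; lia. }
  left; lia.
Qed.

Definition norm1 (P : point) : Z := let '(x, y, z) := P in Z.abs x + Z.abs y + Z.abs z.

(** Induction on the l1 norm, which a shift by a nonzero [u] strictly lowers; repeated shifts
    therefore end in the core. *)
Lemma all_good (P : point) : inV P -> good P.
Proof.
  assert (Hwf : well_founded (fun P Q => 0 <= norm1 P < norm1 Q)).
  { intros Q; apply (well_founded_lt_compat _ (fun P => Z.to_nat (norm1 P))); lia. }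
  induction P as [P IH] using (well_founded_induction Hwf); intros HV.
  destruct (gap_or_core P) as [(HX & HY & HZ) | (t & u & Ht & Hu & HP)].
  { now apply good_core. }
  apply (good_shift t u); trivial.
  apply IH; [| now apply inV_sub4].
  destruct P as [[x y] z], u as [[a b] c].
  assert (H0 : 0 < Z.abs a + Z.abs b + Z.abs c).
  { enough (a <> 0 \/ b <> 0 \/ c <> 0) by lia.
    destruct (Z.eq_dec a 0), (Z.eq_dec b 0), (Z.eq_dec c 0); auto; subst.
    now contradict Hu. }
  assert (Habs : forall u v, beyond 7 t u v -> Z.abs (v - 4 * u) + Z.abs u <= Z.abs v)
    by (unfold beyond; lia).
  destruct HP as (Hx & Hy & Hz); unfold norm1, sub4.
  split; [lia |].
  apply Habs in Hx, Hy, Hz; clear -H0 Hx Hy Hz; lia.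
Qed.

(** * From the local facts to distances *)

Lemma inV_O : inV O_pt.
Proof. now apply inVbP. Qed.

Lemma walk_h2 (m : nat) (P : point) : walk m O_pt P -> h2 P <= 2 * Z.of_nat m.
Proof.
  remember O_pt as P0 eqn:E0.
  (* Membership in [inV] is carried along because the edge bound is applied at the last vertex but
     one. The base case uses [h2 O_pt = 0]. *)
  enough (walk m P0 P -> inV P /\ h2 P <= 2 * Z.of_nat m) by tauto.
  induction 1 as [P VP | m P Q R HW IH HQR VR]; subst.
  - now split.
  - split; [assumption |].
    destruct (IH eq_refl) as [VQ HQ].
    pose proof (proj1 (all_good Q VQ) R HQR VR); lia.
Qed.

Lemma adj_sym (P Q : point) : adj P Q -> adj Q P.
Proof. destruct P as [[x y] z], Q as [[x' y'] z']; simpl; nia. Qed.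

(** Descending by 2 at each step must stop, and can stop only at [O_pt], where [h2] is 0; the
    reversed path has length [h2 P / 2]. *)
Lemma walk_exists (P : point) :
  inV P -> exists n, walk n O_pt P /\ h2 P = 2 * Z.of_nat n.
Proof.
  assert (Hwf : well_founded (fun P Q => h2 P < h2 Q)).
  { intros Q; apply (well_founded_lt_compat _ (fun P => Z.to_nat (h2 P + 7))).
    intros P1 P2; pose proof (h2_lower P1); lia. }
  induction P as [P IH] using (well_founded_induction Hwf); intros HV.
  destruct (proj2 (all_good P HV)) as [-> | (Q & HQ & VQ & E)].
  - exists 0%nat; split; [constructor; exact inV_O | reflexivity].
  - destruct (IH Q) as (n & HW & Hn); [lia | assumption |].
    exists (S n); split; [| lia].
    econstructor; eauto using adj_sym.
Qed.

Theorem theorem1 : forall P : point, inV P ->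
  exists n : nat, graph_dist O_pt P n /\ INR n = h P.
Proof.
  intros P HV; destruct (walk_exists P HV) as (n & HW & Hn).
  exists n; repeat split; trivial.
  (* Minimality: [2n = h2 P] is at most [2m] for any walk of length [m]. *)
  - intros m Hm; apply walk_h2 in Hm; lia.
  - pose proof (h2_double P) as E.
    rewrite Hn, mult_IZR, <- INR_IZR_INZ in E; lra.
Qed.
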